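(* Assume that the iteration $$\big[\boldsymbol{\varphi}_{j+1}-\boldsymbol{\varphi}_j\big]\boldsymbol{\gamma}_j^{-1}=-\mathcal L\,\hat{\boldsymbol{\varphi}}_j,\qquad \big[\hat{\boldsymbol{\varphi}}_j-\hat{\boldsymbol{\varphi}}_{j-1}\big]\hat{\boldsymbol{\gamma}}_j^{-1}=\mathcal L^T\boldsymbol{\varphi}_j,\qquad j\ge0,$$ with initial conditions $\boldsymbol{\varphi}_0=\boldsymbol{b}$, $\hat{\boldsymbol{\varphi}}_{-1}=\boldsymbol{0}$, and with $m\times m$ symmetric matrix coefficients $$\hat{\boldsymbol{\gamma}}_j=\langle\boldsymbol{\varphi}_j,\boldsymbol{\varphi}_j\rangle^{-1},\qquad \boldsymbol{\gamma}_j=\langle\hat{\boldsymbol{\varphi}}_j,\hat{\boldsymbol{\varphi}}_j\rangle^{-1},$$ does not break down for $j=0,\ldots,n-1$, i.e. the columns in each $\boldsymbol{\varphi}_j$ and in each $\hat{\boldsymbol{\varphi}}_j$ are linearly independent for these $j$, so that $\boldsymbol{\gamma}_j$ and $\hat{\boldsymbol{\gamma}}_j$ are defined. Then there exists a choice of square roots $\boldsymbol{\Gamma}_j,\hat{\boldsymbol{\Gamma}}_j\in\mathbb R^{m\times m}$ of these coefficients, $$\boldsymbol{\gamma}_j=\boldsymbol{\Gamma}_j\boldsymbol{\Gamma}_j^T,\qquad \hat{\boldsymbol{\gamma}}_j=\hat{\boldsymbol{\Gamma}}_j\hat{\boldsymbol{\Gamma}}_j^T,\qquad j=0,\ldots,n-1,$$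 which relates the orthonormal primary and dual snapshots $\boldsymbol{v}_j$, $\hat{\boldsymbol{v}}_j$ to the solution of the iteration by $$\boldsymbol{v}_j=\boldsymbol{\varphi}_j\,\hat{\boldsymbol{\Gamma}}_j,\qquad \hat{\boldsymbol{v}}_j=\hat{\boldsymbol{\varphi}}_j\,\boldsymbol{\Gamma}_j,\qquad j=0,\ldots,n-1.$$ Moreover, the $m\times m$ block entries of the block lower bidiagonal ROM matrix $\boldsymbol{\mathcal L}^{ROM}$ are given by these square roots as $$\boldsymbol{\mathcal L}^{ROM}_{j,j}=\hat{\boldsymbol{\Gamma}}_j^{-1}\boldsymbol{\Gamma}_j^{-T},\quad j=0,\ldots,n-1,\qquad \boldsymbol{\mathcal L}^{ROM}_{j+1,j}=-\hat{\boldsymbol{\Gamma}}_{j+1}^{-1}\boldsymbol{\Gamma}_j^{-T},\quad j=0,\ldots,n-2.$$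
   Context: Setting. $H$ is the real Hilbert space $L^2(\Omega)$ of (possibly vector valued) wave fields on a domain $\Omega\subset\mathbb R^d$. $L(q)$ is a first order partial differential operator (with homogeneous boundary conditions built into its domain) with adjoint $L(q)^T$. The results do not depend on the specific form of $L(q)$; what matters is that $L(q)L(q)^T$ is a self-adjoint nonnegative-definite operator on $H$. Let $\tau>0$ and let $m\ge1$, $n\ge2$ be integers. Wave propagator: $\mathcal P=\cos\big(\tau\sqrt{L(q)L(q)^T}\big)$, defined by functional calculus (bounded, self-adjoint, spectrum in $[-1,1]$). $\mathcal L$ denotes a (square root) factor of the nonnegative operator $\frac{2}{\tau^2}(I-\mathcal P)$: a bounded operator $\mathcal L:\hat H\to H$ from a real Hilbert space $\hat H$ (of dual wave fields) with adjoint $\mathcal L^T:H\to\hat H$ such that $$\frac{2}{\tau^2}(I-\mathcal P)=\mathcal L\mathcal L^T.$$ Block conventions. An $m$-tuple $\boldsymbol{w}=(w^{(1)},\ldots,w^{(m)})$ of elements of $H$ (or $\hat H$) is regarded as a row with $m$ columns; operators act on it entrywise, matrices multiply it on the right. $\langle\boldsymbol{v},\boldsymbol{w}\rangle$ is the $m\times m$ matrix with entries $\langle v^{(r)},w^{(s)}\rangle$. A quasimatrix $\boldsymbol{W}=(\boldsymbol{w}_0,\ldots,\boldsymbol{w}_{n-1})$ is a row of $n$ such $m$-tuples; for two quasimatrices in the same space, $\boldsymbol{W}^T\boldsymbol{Z}$ is the $nm\times nm$ matrix with $m\times m$ blocks $\langle\boldsymbol{w}_i,\boldsymbol{z}_j\rangle$,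 $i,j=0,\ldots,n-1$. $\boldsymbol{e}_j\in\mathbb R^{nm\times m}$ has the identity $\boldsymbol{I}_m$ in block position $j$ (counted from $0$) and zeros elsewhere. $\boldsymbol{A}^{-T}$ is the transpose of $\boldsymbol{A}^{-1}$. In the iteration of the claim, $\boldsymbol{\varphi}_j$ are $m$-tuples in $H$ and $\hat{\boldsymbol{\varphi}}_j$ are $m$-tuples in $\hat H$. Snapshots. $\boldsymbol{b}$ is a given $m$-tuple in $H$, $\boldsymbol{u}_j=\cos\big(j\tau\sqrt{L(q)L(q)^T}\big)\boldsymbol{b}$, and $\boldsymbol{U}=(\boldsymbol{u}_0,\ldots,\boldsymbol{u}_{n-1})$. Standing assumption: the snapshots are linearly independent up to time $n\tau$, i.e. all the components of $\boldsymbol{u}_0,\ldots,\boldsymbol{u}_n$ are linearly independent in $H$. Dual snapshots: $m$-tuples in $\hat H$ defined by $\hat{\boldsymbol{u}}_0=\frac{\tau}{2}\mathcal L^T\boldsymbol{b}$ and $\hat{\boldsymbol{u}}_j=\hat{\boldsymbol{u}}_{j-1}+\tau\mathcal L^T\boldsymbol{u}_j$ for $j\ge1$; $\hat{\boldsymbol{U}}=(\hat{\boldsymbol{u}}_0,\ldots,\hat{\boldsymbol{u}}_{n-1})$. ROM. $\boldsymbol{M}=\boldsymbol{U}^T\boldsymbol{U}$, $\boldsymbol{S}=\boldsymbol{U}^T\mathcal P\boldsymbol{U}$; $\boldsymbol{M}=\boldsymbol{R}^T\boldsymbol{R}$ is a block Cholesky factorization with $\boldsymbol{R}$ block upper triangular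 (invertible); $\boldsymbol{\mathcal P}^{ROM}=\boldsymbol{R}^{-T}\boldsymbol{S}\boldsymbol{R}^{-1}$; $\boldsymbol{b}^{ROM}=\boldsymbol{R}\boldsymbol{e}_0$. The ROM snapshots $\boldsymbol{u}^{ROM}_j\in\mathbb R^{nm\times m}$ satisfy $\boldsymbol{u}^{ROM}_{j+1}=2\boldsymbol{\mathcal P}^{ROM}\boldsymbol{u}^{ROM}_j-\boldsymbol{u}^{ROM}_{j-1}$ for $j\ge0$, with $\boldsymbol{u}^{ROM}_0=\boldsymbol{b}^{ROM}$, $\boldsymbol{u}^{ROM}_1=\boldsymbol{u}^{ROM}_{-1}=\boldsymbol{R}\boldsymbol{e}_1$. The matrix $\boldsymbol{\mathcal L}^{ROM}\in\mathbb R^{nm\times nm}$ is the block lower triangular (in fact block lower bidiagonal and invertible) factor in the block Cholesky factorization $\frac{2}{\tau^2}(\boldsymbol{I}_{nm}-\boldsymbol{\mathcal P}^{ROM})=\boldsymbol{\mathcal L}^{ROM}(\boldsymbol{\mathcal L}^{ROM})^T$. The ROM dual snapshots are $\hat{\boldsymbol{u}}^{ROM}_0=\frac{\tau}{2}(\boldsymbol{\mathcal L}^{ROM})^T\boldsymbol{b}^{ROM}$ and $\hat{\boldsymbol{u}}^{ROM}_j=\hat{\boldsymbol{u}}^{ROM}_{j-1}+\tau(\boldsymbol{\mathcal L}^{ROM})^T\boldsymbol{u}^{ROM}_j$ for $j\ge1$. Orthonormal snapshots. The orthonormal primary snapshots are the block columns of $\boldsymbol{V}=(\boldsymbol{v}_0,\ldots,\boldsymbol{v}_{n-1})=\boldsymbol{U}\boldsymbol{R}^{-1}$.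 The orthonormal dual snapshots are the block columns of the quasimatrix $\hat{\boldsymbol{V}}=(\hat{\boldsymbol{v}}_0,\ldots,\hat{\boldsymbol{v}}_{n-1})$ with orthonormal columns determined by $\hat{\boldsymbol{U}}=\hat{\boldsymbol{V}}\hat{\boldsymbol{R}}$, where $\hat{\boldsymbol{R}}=(\hat{\boldsymbol{u}}^{ROM}_0,\ldots,\hat{\boldsymbol{u}}^{ROM}_{n-1})$ is block upper triangular and invertible; equivalently $\hat{\boldsymbol{V}}=\mathcal L^T\boldsymbol{V}(\boldsymbol{\mathcal L}^{ROM})^{-T}$. *)

(* Defs.v *)
From HB Require Import structures.
From mathcomp Require Export all_boot all_order all_algebra.
From mathcomp Require Export all_classical all_reals all_analysis.
Export Order.TTheory GRing.Theory Num.Theory.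
Export numFieldNormedType.Exports.

Set Implicit Arguments.
Unset Strict Implicit.
Unset Printing Implicit Defensive.

Local Open Scope classical_set_scope.
Local Open Scope ring_scope.

Structure hilbertType (R : realType) := HilbertType {
  hilbert_sort :> completeNormedModType R;
  hilbert_dot : {dot hilbert_sort for idfun};
  hilbert_normE : forall x : hilbert_sort, `|x| ^+ 2 = hilbert_dot x x
}.

Definition ip (R : realType) (H : hilbertType R) (x y : H) : R :=
  hilbert_dot H x y.

(* Unbounded operators are represented by their graphs. *)
Section Unbounded.
Variable R : realType.
Implicit Types H K : hilbertType R.

Definition op_dom K H (L : set (K * H)) : set K :=
  [set x | exists y, L (x, y)].

Definition densely_defined_operator K H (L : set (K * H)) : Prop :=
  [/\ forall y, L (0, y) <-> y = 0,
      forall (a : R) x y x' y', L (x, y) -> L (x', y') ->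
        L (a *: x + x', a *: y + y')
    & dense (op_dom L)].

Definition op_adjoint K H (L : set (K * H)) : set (H * K) :=
  [set yz | forall x w, L (x, w) -> ip w yz.1 = ip x yz.2].

Definition op_comp K H G (L : set (K * H)) (N : set (G * K)) : set (G * H) :=
  [set xz | exists2 y, N (xz.1, y) & L (y, xz.2)].

Definition op_self_adjoint H (A : set (H * H)) : Prop :=
  densely_defined_operator A /\ op_adjoint A = A.

Definition op_nonneg H (A : set (H * H)) : Prop :=
  forall x y, A (x, y) -> 0 <= ip y x.

Definition bounded_operator K H (T : K -> H) : Prop :=
  exists M : R, forall x, `|T x| <= M * `|x|.

End Unbounded.

Section FunctionalCalculus.
Variables (R : realType) (H : hilbertType R).

(* E is a projection-valued Borel measure on R and
   mu x is the scalar measure B |-> <E(B) x, x>. *)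
Record projection_valued_measure (E : set (measurableTypeR R) -> H -> H)
    (mu : H -> {measure set (measurableTypeR R) -> \bar R}) : Prop := {
  pvm_linear : forall B, measurable B -> forall (a : R) x y,
    E B (a *: x + y) = a *: E B x + E B y;
  pvm_sym : forall B, measurable B -> forall x y, ip (E B x) y = ip x (E B y);
  pvm_setT : forall x, E setT x = x;
  pvm_setI : forall B B', measurable B -> measurable B' -> forall x,
    E (B `&` B') x = E B (E B' x);
  pvm_measure : forall B, measurable B -> forall x,
    mu x B = (ip (E B x) x)%:E
}.

(* The spectral theorem A = \int l dE(l): the domain of A is the set of x with
   \int l^2 d<E x, x> finite, and <A x, x> = \int l d<E x, x> there, which
   determines the symmetric operator A by polarization. *)
Definition spectral_measure (A : set (H * H))
    (E : set (measurableTypeR R) -> H -> H)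
    (mu : H -> {measure set (measurableTypeR R) -> \bar R}) : Prop :=
  [/\ projection_valued_measure E mu,
      forall x, op_dom A x <->
        (\int[mu x]_(l in setT) ((l : R) ^+ 2)%:E < +oo)%E
    & forall x y, A (x, y) -> ip y x = \int[mu x]_(l in setT) (l : R)].

(* T = f(A) for a bounded Borel function f, i.e. <T x, y> = \int f d<E x, y>;
   the signed measure <E x, y> is expanded by polarization. *)
Definition functional_calculus
    (mu : H -> {measure set (measurableTypeR R) -> \bar R})
    (f : R -> R) (T : H -> H) : Prop :=
  forall x y, ip (T x) y =
    (\int[mu (x + y)]_(l in setT) f l - \int[mu (x - y)]_(l in setT) f l) / 4.

End FunctionalCalculus.

(* Tuples and quasimatrices with p columns in H are rows 'rV[H]_p; those made of
   n blocks of m columns have p = \sum_(j < n) m, the size used by \mxrow. *)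
Section Quasimatrices.
Variables (R : realType) (H : hilbertType R).

Definition qmulmx p q (W : 'rV[H]_p) (A : 'M[R]_(p, q)) : 'rV[H]_q :=
  \row_s \sum_r A r s *: W 0 r.

Definition gram p q (W : 'rV[H]_p) (Z : 'rV[H]_q) : 'M[R]_(p, q) :=
  \matrix_(r, s) ip (W 0 r) (Z 0 s).

Definition lin_indep p (W : 'rV[H]_p) : Prop :=
  forall c : 'cV[R]_p, qmulmx W c = 0 -> c = 0.

Definition quasimx m n (w : nat -> 'rV[H]_m) : 'rV[H]_(\sum_(j < n) m) :=
  \mxrow_(j < n) w j.

End Quasimatrices.

Notation "W *q A" := (qmulmx W A) (at level 40, left associativity) : ring_scope.

Section Blocks.
Variables (R : realType) (m n : nat).

Definition block_col (j : nat) : 'M[R]_(\sum_(i < n) m, m) :=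
  \mxcol_(i < n) ((i == j :> nat)%:R%:M : 'M[R]_m).

Definition block_upper (A : 'M[R]_(\sum_(i < n) m)) : Prop :=
  forall i j : 'I_n, (j < i)%N -> submxblock A i j = 0.

Definition block_lower (A : 'M[R]_(\sum_(i < n) m)) : Prop :=
  forall i j : 'I_n, (i < j)%N -> submxblock A i j = 0.

End Blocks.

Section Snapshots.
Variables (R : realType) (H Hh : hilbertType R) (m : nat) (tau : R).

(* C t stands for cos (t * sqrt A) *)
Definition snapshot (C : R -> H -> H) (b : 'rV[H]_m) (j : nat) : 'rV[H]_m :=
  map_mx (C (j%:R * tau)) b.

Fixpoint dual_snapshot (LcT : H -> Hh) (b : 'rV[H]_m) (u : nat -> 'rV[H]_m)
    (j : nat) : 'rV[Hh]_m :=
  if j is k.+1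
  then dual_snapshot LcT b u k + map_mx (fun x => tau *: LcT x) (u k.+1)
  else map_mx (fun x => (tau / 2) *: LcT x) b.

End Snapshots.

Section ROM.
Variables (R : realType) (m n : nat) (tau : R).
Local Notation N := (\sum_(i < n) m)%N.

Definition rom_propagator (S Rc : 'M[R]_N) : 'M[R]_N :=
  (invmx Rc)^T *m S *m invmx Rc.

(* The recurrence at j = 0, with u_{-1} = u_1 = R e_1, reads P^ROM R e_0 = R e_1;
   it holds because P u_0 = u_1. *)
Fixpoint rom_snapshot (P Rc : 'M[R]_N) (j : nat) : 'M[R]_(N, m) :=
  match j with
  | 0 => Rc *m block_col R m n 0
  | k.+1 =>
    match k with
    | 0 => Rc *m block_col R m n 1
    | l.+1 => 2 *: (P *m rom_snapshot P Rc k) - rom_snapshot P Rc l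
    end
  end.

Fixpoint rom_dual_snapshot (L : 'M[R]_N) (b : 'M[R]_(N, m))
    (u : nat -> 'M[R]_(N, m)) (j : nat) : 'M[R]_(N, m) :=
  if j is k.+1 then rom_dual_snapshot L b u k + tau *: (L^T *m u k.+1)
  else (tau / 2) *: (L^T *m b).

End ROM.

Section Iteration.
Variables (R : realType) (H Hh : hilbertType R) (m : nat).

Definition coef (K : hilbertType R) (phi : nat -> 'rV[K]_m) (j : nat) : 'M[R]_m :=
  invmx (gram (phi j) (phi j)).

(* gamma_j is the coefficient of phih and gammah_j that of phi. *)
Definition block_iteration (n : nat) (Lc : Hh -> H) (LcT : H -> Hh)
    (b : 'rV[H]_m) (phi : nat -> 'rV[H]_m) (phih : nat -> 'rV[Hh]_m) : Prop :=
  phi 0 = b /\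
  forall j, (j < n)%N ->
    let phih_prev := if j is k.+1 then phih k else 0 in
    (phi j.+1 - phi j) *q invmx (coef phih j) = - map_mx Lc (phih j) /\
    (phih j - phih_prev) *q invmx (coef phi j) = map_mx LcT (phi j).

End Iteration.

(* Main.v *)
Require Import Defs.
From mathcomp Require Import measurable_realfun ring lra.

(** The snapshots, orthogonalized, are the block Lanczos vectors, and block
    Lanczos vectors are unique up to orthogonal factors; those factors are
    absorbed in the choice of the square roots.

    Functional calculus enters only through the recurrence
    u_(j+1) + u_(j-1) = 2 P u_j, the operator form of
    2 cos s cos t = cos (s + t) + cos (s - t).  The calculus is given by the
    integrals of the function against <E(B) x, y>, so its multiplicativity
    ([functional_calculusM]) has to be derived from E(B B') = E(B) E(B').  This
    is done by comparing bounded functionals of a bounded measurable function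
    which agree on indicators ([bounded_functional_eq0]).

    The recurrence and (2 / tau ^ 2) (I - P) = Lc LcT give the leapfrog relation
    - tau Lc uh_j = u_(j+1) - u_j ([Lc_dual_snapshot]).  It makes the dual
    snapshots linearly independent, and Lc and LcT move the two snapshot
    filtrations into each other.  The ROM reproduces the coordinates of the
    snapshots, so that V and Vh are orthonormal with LcT V = Vh (L^ROM)^T
    ([primary_orthonormal], [dual_orthonormal], [LcT_primary]); thus L^ROM is the
    matrix of Lc in these bases.

    Put X_j = <v_j, phi_j> and Y_j = <vh_j, phih_j>.  By induction on j
    ([iteration_matched]) one has phi_j = v_j X_j and phih_j = vh_j Y_j with
    L_(j,j) = X_j Y_j^T and L_(j+1,j) = - X_(j+1) Y_j^T.  Indeed Lc vh_j is a
    combination of v_j and v_(j+1) only: L^ROM is block lower triangular, and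
    Lc vh_j lies in the span of v_0, ..., v_(j+1) because phih_j lies in the span
    of uh_0, ..., uh_j.  Each step of the iteration then cancels the component
    along the old block and leaves a multiple of the new one.  Linear
    independence of phi_j and phih_j makes X_j and Y_j invertible, and their
    inverses are the required square roots, since <phi_j, phi_j> = X_j^T X_j. *)

Set Implicit Arguments.
Unset Strict Implicit.
Unset Printing Implicit Defensive.

Local Open Scope classical_set_scope.
Local Open Scope ring_scope.

(** * Real inner products *)

Section InnerProduct.
Variables (R : realType) (H : hilbertType R).
Implicit Types (x y z : H) (a : R).

Lemma ipC x y : ip x y = ip y x.
Proof. by rewrite /ip hermC expr0 mul1r. Qed.
Lemma ipDl x y z : ip (x + y) z = ip x z + ip y z.
Proof. exact: linearDl. Qed.
Lemma ipZl a x z : ip (a *: x) z = a * ip x z.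
Proof. exact: linearZl_LR. Qed.
Lemma ipDr x y z : ip z (x + y) = ip z x + ip z y.
Proof. exact: linearDr. Qed.
Lemma ipZr a x z : ip z (a *: x) = a * ip z x.
Proof. exact: linearZr_LR. Qed.
Lemma ipNl x z : ip (- x) z = - ip x z.
Proof. exact: linearNl. Qed.
Lemma ipNr x z : ip z (- x) = - ip z x.
Proof. exact: linearNr. Qed.
Lemma ip0r z : ip z 0 = 0.
Proof. exact: linear0r. Qed.
Lemma ip_sumr I (s : seq I) (P : pred I) (F : I -> H) z :
  ip z (\sum_(i <- s | P i) F i) = \sum_(i <- s | P i) ip z (F i).
Proof. exact: linear_sumr. Qed.
Lemma ip_eq0 x : ip x x = 0 -> x = 0.
Proof.
by move=> x0; apply/eqP; rewrite -normr_eq0 -sqrf_eq0 hilbert_normE; apply/eqP.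
Qed.
Lemma ip_inj x y : (forall z, ip x z = ip y z) -> x = y.
Proof.
move=> xy; apply/eqP; rewrite -subr_eq0; apply/eqP/ip_eq0.
by rewrite ipDl ipNl xy subrr.
Qed.
End InnerProduct.


(** * Functionals on bounded measurable functions *)

Section BoundedMeasurable.
Variables (R : realType) (d : measure_display) (T : measurableType d).
Implicit Types (f g : T -> R) (B : set T).

Definition bounded_measurable f :=
  measurable_fun setT f /\ exists M, forall t, `|f t| <= M.

Lemma bounded_measurable_indic B : measurable B -> bounded_measurable \1_B.
Proof.
move=> mB; split; first exact: measurable_indic.
by exists 1 => t; rewrite indicE; case: (_ \in _); rewrite /= ?normr1 ?normr0.
Qed.

Lemma bounded_measurableD f g : bounded_measurable f -> bounded_measurable g ->
  bounded_measurable (fun t => f t + g t).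
Proof.
move=> [mf [M fM]] [mg [N gN]]; split; first exact: measurable_funD.
by exists (M + N) => t; rewrite (le_trans (ler_normD _ _))// lerD.
Qed.

Lemma bounded_measurableM f g : bounded_measurable f -> bounded_measurable g ->
  bounded_measurable (fun t => f t * g t).
Proof.
move=> [mf [M fM]] [mg [N gN]]; split; first exact: measurable_funM.
by exists (M * N) => t; rewrite normrM ler_pM.
Qed.

Lemma bounded_measurableZ c f : bounded_measurable f ->
  bounded_measurable (fun t => c * f t).
Proof.
move=> bf; apply: bounded_measurableM => //; split; first exact: measurable_cst.
by exists `|c|.
Qed.

(** The uniform density of simple functions, in the form used below.  Up to a
    constant, f takes values in [0, M].  Subtracting M / 2 on the set where
    M / 2 <= f changes f by a multiple of an indicator, hence leaves J f
    unchanged, and brings the values into [0, M / 2].  Iterating, J f is the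
    value of J at functions with arbitrarily small bounds, so J f = 0.  The
    first hypothesis combines additivity with the vanishing of J on
    indicators. *)
Lemma bounded_functional_eq0 (J : (T -> R) -> R) (K : R) :
  (forall f c B, bounded_measurable f -> measurable B ->
    J (fun t => f t + c * \1_B t) = J f) ->
  (forall f M, measurable_fun setT f -> (forall t, `|f t| <= M) ->
    `|J f| <= K * M) ->
  forall f, bounded_measurable f -> J f = 0.
Proof.
move=> JB JM f bf.
have [_ [M0 fM0]] := bf.
pose M := `|M0| + `|M0|.
have small : forall k, exists g, [/\ measurable_fun setT g,
    forall t, 0 <= g t <= M / 2 ^+ k & J g = J f].
  elim=> [|k [g [mg gM Jg]]].
    exists (fun t => f t + `|M0| * \1_setT t); split.
    - apply: measurable_funD; first by have [] := bf.
      by apply: measurable_funM => //; exact: measurable_indic.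
    - move=> t; rewrite indicE in_setT mulr1 expr0 divr1 /M.
      have := fM0 t; have := ler_norm M0; rewrite ler_norml; lra.
    - exact: JB.
  pose B := [set t | M / 2 ^+ k.+1 <= g t].
  have mB : measurable B.
    have -> : B = setT `&` (g @^-1` `[M / 2 ^+ k.+1, +oo[).
      by rewrite setTI; apply/seteqP; split=> t /=; rewrite in_itv/= andbT.
    exact: mg.
  exists (fun t => g t + (- (M / 2 ^+ k.+1)) * \1_B t); split.
  - apply: measurable_funD => //.
    by apply: measurable_funM => //; exact: measurable_indic.
  - move=> t; have := gM t; rewrite indicE.
    have -> : M / 2 ^+ k = M / 2 ^+ k.+1 + M / 2 ^+ k.+1.
      rewrite exprS; field; exact: expf_neq0.
    case: (boolP (t \in B)); rewrite /B ?inE /= ?notin_setE /=.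
      by move=> ?; rewrite mulr1; lra.
    by rewrite mulr0 addr0 => /negP; rewrite -ltNge; lra.
  - rewrite JB// -?Jg//; split=> //; exists (M / 2 ^+ k) => t.
    by have /andP[g0 gk] := gM t; rewrite ger0_norm.
apply/eqP; rewrite -normr_le0; apply/ler_addgt0Pl => e e0; rewrite addr0.
(* k with 2 ^ k >= K M / e exists because k < 2 ^ k *)
have [k kP] : exists k, `|K| * M <= e * 2 ^+ k.
  exists (Num.truncn (`|K| * M / e)).+1.
  rewrite [leRHS]mulrC -ler_pdivrMr//; apply: (le_trans (ltW (Num.Theory.truncnS_gt _))).
  by rewrite -natrX ler_nat ltnW// ltn_expl.
have [g [mg gM <-]] := small k.
apply: (le_trans (JM g (M / 2 ^+ k) mg _)).
  by move=> t; have /andP[g0 gk] := gM t; rewrite ger0_norm.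
have M0' : 0 <= M / 2 ^+ k by rewrite divr_ge0// ?addr_ge0// exprn_ge0.
apply: (le_trans (ler_wpM2r M0' (ler_norm K))).
by rewrite mulrA ler_pdivrMr// exprn_gt0.
Qed.
End BoundedMeasurable.

(** * Multiplicativity of the functional calculus *)

Section FunctionalCalculusTheory.
Variables (R : realType) (H : hilbertType R).
Variables (E : set (measurableTypeR R) -> H -> H).
Variable (mu : H -> {measure set (measurableTypeR R) -> \bar R}).
Hypothesis pvm : projection_valued_measure E mu.
Local Notation T := (measurableTypeR R).
Implicit Types (f g : T -> R) (x y z : H) (B : set T).

(** The integral of f against the signed measure B |-> <E(B) x, y>, written by
    polarization with the positive measures [mu]. *)
Definition spectral_form f x y : R :=
  (\int[mu (x + y)]_(l in setT) f l - \int[mu (x - y)]_(l in setT) f l) / 4.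

Lemma spectral_measure_fin z : (mu z setT < +oo)%E.
Proof. by rewrite (pvm_measure pvm)// ltry. Qed.

Lemma spectral_integrable f z : bounded_measurable f ->
  (mu z).-integrable setT (EFin \o f).
Proof.
move=> [mf [M fM]]; apply: measurable_bounded_integrable => //.
  exact: spectral_measure_fin.
exists M; split; rewrite ?num_real// => N MN t _.
exact: le_trans (fM t) (ltW MN).
Qed.

Lemma spectral_formD f g x y : bounded_measurable f -> bounded_measurable g ->
  spectral_form (fun t => f t + g t) x y =
  spectral_form f x y + spectral_form g x y.
Proof.
move=> bf bg; rewrite /spectral_form !RintegralD//; try exact: spectral_integrable.
lra.
Qed.

Lemma spectral_formZ c f x y : bounded_measurable f ->
  spectral_form (fun t => c * f t) x y = c * spectral_form f x y.
Proof.
move=> bf; rewrite /spectral_form !RintegralZl//; try exact: spectral_integrable.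
by rewrite -mulrBr mulrA.
Qed.

Lemma spectral_form_indic B x y : measurable B ->
  spectral_form \1_B x y = ip (E B x) y.
Proof.
move=> mB; rewrite /spectral_form.
have intB z : \int[mu z]_(l in setT) \1_B l = ip (E B z) z.
  rewrite /Rintegral integral_indic// setIT (pvm_measure pvm)//.
have ED u v : E B (u + v) = E B u + E B v.
  by have := pvm_linear pvm mB 1 u v; rewrite !scale1r.
have EN v : E B (- v) = - E B v.
  have E0 : E B 0 = 0.
    by apply: (addIr (E B 0)); rewrite add0r -ED addr0.
  by have := pvm_linear pvm mB (-1) v 0; rewrite E0 !addr0 !scaleN1r.
have EC : ip (E B y) x = ip (E B x) y by rewrite (pvm_sym pvm)// ipC.
rewrite !intB !ED !EN !(ipDl, ipDr, ipNl, ipNr) EC; lra.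
Qed.

Lemma spectral_form_bound f M x y : measurable_fun setT f ->
  (forall t, `|f t| <= M) ->
  `|spectral_form f x y| <= (ip (x + y) (x + y) + ip (x - y) (x - y)) * M.
Proof.
move=> mf fM.
have bd z : `|\int[mu z]_(l in setT) f l| <= M * ip z z.
  have bf : bounded_measurable f by split => //; exists M.
  apply: (le_trans (le_normr_Rintegral _ (spectral_integrable z bf))) => //.
  have -> : M * ip z z = \int[mu z]_(l in setT) M.
    by rewrite Rintegral_cst// (pvm_measure pvm)// (pvm_setT pvm).
  apply: le_Rintegral => //; apply: spectral_integrable.
    by split; [exact: measurableT_comp|exists M => t; rewrite normr_id].
  by split; [exact: measurable_cst|exists `|M|].
rewrite /spectral_form normrM normfV (@ger0_norm _ 4)//.
have := le_trans (ler_normB _ _) (lerD (bd (x + y)) (bd (x - y))).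
have := normr_ge0 (\int[mu (x + y)]_(l in setT) f l - \int[mu (x - y)]_(l in setT) f l).
lra.
Qed.

(** Both sides are bounded functionals of f.  On the indicator of B' they are
    <E(B' B) x, y> and <E(B') x, E(B) y>, which agree because E(B) is
    symmetric and E(B' B) = E(B) E(B'). *)
Lemma spectral_form_localize f B x y : bounded_measurable f -> measurable B ->
  spectral_form (fun t => f t * \1_B t) x y = spectral_form f x (E B y).
Proof.
move=> bf mB; apply/eqP; rewrite -subr_eq0; apply/eqP.
pose K1 := ip (x + y) (x + y) + ip (x - y) (x - y).
pose K2 := ip (x + E B y) (x + E B y) + ip (x - E B y) (x - E B y).
apply: (bounded_functional_eq0 (J := fun f => spectral_form (fun t => f t * \1_B t) x y
  - spectral_form f x (E B y)) (K := K1 + K2)) => //.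
- move=> {bf}f c B' bf mB'.
  have -> : (fun t => (f t + c * \1_B' t) * \1_B t) =
            (fun t => f t * \1_B t + c * \1_(B' `&` B) t).
    by apply/funext => t; rewrite indicI /= mulrDl mulrA.
  have bB := bounded_measurable_indic R mB.
  have bB' := bounded_measurable_indic R mB'.
  have mI := measurableI _ _ mB' mB; have bI := bounded_measurable_indic R mI.
  rewrite !spectral_formD ?spectral_formZ ?spectral_form_indic//;
    try by do ?[exact: bounded_measurableZ|exact: bounded_measurableM].
  rewrite setIC (pvm_setI pvm)// (pvm_sym pvm mB) opprD addrACA.
  by rewrite subrr addr0.
- move=> {bf}f M mf fM.
  apply: (le_trans (ler_normB _ _)); rewrite mulrDl lerD//.
    apply: spectral_form_bound => [|t].
      by apply: measurable_funM => //; exact: measurable_indic.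
    rewrite indicE; case: (_ \in _); rewrite /= ?mulr1// mulr0 normr0.
    exact: le_trans (normr_ge0 _) (fM t).
  exact: spectral_form_bound.
Qed.

(** As functionals of f, the forms of f g at (x, y) and of f at (G x, y) are
    bounded.  On the indicator of B the first is the form of g at
    (x, E(B) y), by localization, that is <G x, E(B) y>; the second is
    <E(B) G x, y>.  Hence they agree on every bounded f. *)
Lemma functional_calculusM f g (F G FG : H -> H) :
  bounded_measurable f -> bounded_measurable g ->
  functional_calculus mu f F -> functional_calculus mu g G ->
  functional_calculus mu (fun l => f l * g l) FG ->
  forall x, FG x = F (G x).
Proof.
move=> bf bg hF hG hFG x; apply: ip_inj => y.
rewrite hFG hF -/(spectral_form (fun l => f l * g l) x y).
rewrite -/(spectral_form f (G x) y).
have [mg [Mg gMg]] := bg.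
apply/eqP; rewrite -subr_eq0; apply/eqP.
pose K1 := ip (x + y) (x + y) + ip (x - y) (x - y).
pose K2 := ip (G x + y) (G x + y) + ip (G x - y) (G x - y).
apply: (bounded_functional_eq0 (J := fun f => spectral_form (fun t => f t * g t) x y
  - spectral_form f (G x) y) (K := K1 * Mg + K2)) => //.
- move=> {bf hF hFG}f c B bf mB.
  have -> : (fun t => (f t + c * \1_B t) * g t) =
            (fun t => f t * g t + c * (g t * \1_B t)).
    by apply/funext => t; rewrite mulrDl -mulrA [\1_B t * _]mulrC.
  have bB : bounded_measurable (\1_B : T -> R) := bounded_measurable_indic R mB.
  have bgB := bounded_measurableM bg bB; have bfg := bounded_measurableM bf bg.
  rewrite !spectral_formD ?spectral_formZ ?spectral_form_indic//;
    try by exact: bounded_measurableZ.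
  rewrite spectral_form_localize// (pvm_sym pvm mB) hG.
  by rewrite -/(spectral_form g x (E B y)) opprD addrACA subrr addr0.
- move=> {bf hF hFG}f M mf fM.
  apply: (le_trans (ler_normB _ _)); rewrite mulrDl lerD//.
    rewrite -mulrA; apply: spectral_form_bound => [|t].
      exact: measurable_funM.
    by rewrite normrM mulrC ler_pM.
  exact: spectral_form_bound.
Qed.

Lemma bounded_measurable_cos_sqrt (t : R) :
  bounded_measurable (fun l : T => cos (t * Num.sqrt (l : R))).
Proof.
split; last by exists 1 => l; rewrite ler_norml cos_geN1 cos_le1.
apply: measurableT_comp; first exact: continuous_measurable_fun (@continuous_cos R).
apply: measurable_funM; first exact: measurable_cst.
exact: continuous_measurable_fun (@sqrt_continuous R).
Qed.

Variable C : R -> H -> H.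
Hypothesis hC : forall t : R,
  functional_calculus mu (fun l => cos (t * Num.sqrt l)) (C t).

Lemma cos_calculus0 x : C 0 x = x.
Proof.
apply: ip_inj => y; rewrite hC.
have -> : (fun l : T => cos (0 * Num.sqrt (l : R))) = \1_setT.
  by apply/funext => l; rewrite mul0r cos0 indicT.
rewrite -/(spectral_form \1_setT x y) spectral_form_indic//.
by rewrite (pvm_setT pvm).
Qed.

Lemma cos_calculusN t x : C (- t) x = C t x.
Proof.
apply: ip_inj => y; rewrite !hC.
suff -> : (fun l : T => cos (- t * Num.sqrt (l : R))) =
          (fun l : T => cos (t * Num.sqrt (l : R))) by [].
by apply/funext => l; rewrite mulNr cosN.
Qed.

Lemma cos_calculusD s t x : C s (C t x) = 2^-1 *: (C (s + t) x + C (s - t) x).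
Proof.
have bc := bounded_measurable_cos_sqrt.
symmetry; move: x; apply: (functional_calculusM (bc s) (bc t)) => // x y.
rewrite ipZl ipDl !hC.
set cs := fun r : R => (fun l : T => cos (r * Num.sqrt (l : R))).
rewrite -/(spectral_form (cs (s + t)) x y) -/(spectral_form (cs (s - t)) x y).
rewrite -spectral_formD; [|exact: bc..].
rewrite -spectral_formZ; last by apply: bounded_measurableD; exact: bc.
rewrite -/(spectral_form (fun l => cs s l * cs t l) x y); congr spectral_form.
apply/funext => l; rewrite /cs mulrDl mulrBl cosD cosB; lra.
Qed.

End FunctionalCalculusTheory.

(** * Algebra of quasimatrices *)

Section QuasimatrixAlgebra.
Variables (R : realType) (H : hilbertType R).

Lemma qmulmxE p q (W : 'rV[H]_p) (A : 'M[R]_(p, q)) s :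
  (W *q A) 0 s = \sum_r A r s *: W 0 r.
Proof. by rewrite mxE. Qed.

Lemma qmulmxA p q r (W : 'rV[H]_p) (A : 'M[R]_(p, q)) (B : 'M[R]_(q, r)) :
  W *q A *q B = W *q (A *m B).
Proof.
apply/rowP => s; rewrite [LHS]mxE [RHS]mxE.
transitivity (\sum_k \sum_l (A l k * B k s) *: W 0 l).
  apply: eq_bigr => k _; rewrite mxE scaler_sumr.
  by apply: eq_bigr => l _; rewrite scalerA mulrC.
by rewrite exchange_big; apply: eq_bigr => l _; rewrite mxE scaler_suml.
Qed.

Lemma qmulmx1 p (W : 'rV[H]_p) : W *q 1%:M = W.
Proof.
apply/rowP => s; rewrite qmulmxE (bigD1 s)//= big1 => [|r rs].
  by rewrite mxE eqxx scale1r addr0.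
by rewrite mxE (negPf rs) scale0r.
Qed.

Lemma qmulmxDl p q (W Z : 'rV[H]_p) (A : 'M[R]_(p, q)) :
  (W + Z) *q A = W *q A + Z *q A.
Proof.
apply/rowP => s; rewrite [RHS]mxE !qmulmxE -big_split.
by apply: eq_bigr => r _; rewrite mxE scalerDr.
Qed.

Lemma qmulmxDr p q (W : 'rV[H]_p) (A B : 'M[R]_(p, q)) :
  W *q (A + B) = W *q A + W *q B.
Proof.
apply/rowP => s; rewrite [RHS]mxE !qmulmxE -big_split.
by apply: eq_bigr => r _; rewrite mxE scalerDl.
Qed.

Lemma qmulmxNl p q (W : 'rV[H]_p) (A : 'M[R]_(p, q)) : (- W) *q A = - (W *q A).
Proof.
apply/rowP => s; rewrite [RHS]mxE !qmulmxE -sumrN.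
by apply: eq_bigr => r _; rewrite mxE scalerN.
Qed.

Lemma qmulmxNr p q (W : 'rV[H]_p) (A : 'M[R]_(p, q)) : W *q (- A) = - (W *q A).
Proof.
apply/rowP => s; rewrite [RHS]mxE !qmulmxE -sumrN.
by apply: eq_bigr => r _; rewrite mxE scaleNr.
Qed.

Lemma qmulmx0r p q (W : 'rV[H]_p) : W *q (0 : 'M[R]_(p, q)) = 0.
Proof. by rewrite -(subrr (0 : 'M[R]_(p, q))) qmulmxDr qmulmxNr subrr. Qed.

Lemma qmulmx0l p q (A : 'M[R]_(p, q)) : (0 : 'rV[H]_p) *q A = 0.
Proof. by rewrite -(subrr 0) qmulmxDl qmulmxNl subrr. Qed.

Lemma qmulmx_sumr p q (I : Type) (s : seq I) (P : pred I) (W : 'rV[H]_p)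
    (A : I -> 'M[R]_(p, q)) :
  W *q (\sum_(i <- s | P i) A i) = \sum_(i <- s | P i) W *q A i.
Proof. exact: (big_morph _ (qmulmxDr W) (qmulmx0r q W)). Qed.

Lemma qmulmx_suml p q (I : Type) (s : seq I) (P : pred I) (W : I -> 'rV[H]_p)
    (A : 'M[R]_(p, q)) :
  (\sum_(i <- s | P i) W i) *q A = \sum_(i <- s | P i) W i *q A.
Proof.
by elim/big_rec2: _ => [|i x y _ <-]; rewrite ?qmulmx0l ?qmulmxDl.
Qed.

Lemma gram_mulr p q r (W : 'rV[H]_p) (Z : 'rV[H]_q) (A : 'M[R]_(q, r)) :
  gram W (Z *q A) = gram W Z *m A.
Proof.
apply/matrixP => i j; rewrite mxE qmulmxE ip_sumr mxE.
by apply: eq_bigr => k _; rewrite ipZr mulrC mxE.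
Qed.

Lemma gram_tr p q (W : 'rV[H]_p) (Z : 'rV[H]_q) : (gram W Z)^T = gram Z W.
Proof. by apply/matrixP => i j; rewrite !mxE ipC. Qed.

Lemma gram_mull p q r (W : 'rV[H]_p) (Z : 'rV[H]_q) (A : 'M[R]_(p, r)) :
  gram (W *q A) Z = A^T *m gram W Z.
Proof. by rewrite -gram_tr gram_mulr trmx_mul gram_tr. Qed.

Lemma gramDr p q (W : 'rV[H]_p) (Z Z' : 'rV[H]_q) :
  gram W (Z + Z') = gram W Z + gram W Z'.
Proof. by apply/matrixP => i j; rewrite !mxE ipDr. Qed.

Lemma gramNr p q (W : 'rV[H]_p) (Z : 'rV[H]_q) : gram W (- Z) = - gram W Z.
Proof. by apply/matrixP => i j; rewrite !mxE ipNr. Qed.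

Lemma gram_unit p (W : 'rV[H]_p) : lin_indep W -> gram W W \in unitmx.
Proof.
move=> iW; rewrite -row_free_unit; apply: inj_row_free => c c0.
suff W0 : W *q c^T = 0 by rewrite -[c]trmxK (iW _ W0) trmx0.
apply/rowP => s; rewrite [RHS]mxE; apply: ip_eq0.
have /matrixP/(_ s s) : gram (W *q c^T) (W *q c^T) = 0.
  by rewrite gram_mull gram_mulr trmxK mulmxA c0 mul0mx.
by rewrite !mxE.
Qed.

Lemma orthonormal_coord_unit p (W Z : 'rV[H]_p) (A : 'M[R]_p) :
  gram W W = 1%:M -> lin_indep Z -> Z = W *q A -> A \in unitmx.
Proof.
move=> W1 /gram_unit iZ ZE; move: iZ.
by rewrite ZE gram_mull gram_mulr W1 mul1mx unitmx_mul => /andP[].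
Qed.

End QuasimatrixAlgebra.

Section QuasimatrixMap.
Variables (R : realType) (H K : hilbertType R) (f : {linear H -> K}).

Lemma map_qmulmx p q (W : 'rV[H]_p) (A : 'M[R]_(p, q)) :
  map_mx f (W *q A) = map_mx f W *q A.
Proof.
apply/rowP => s; rewrite mxE !qmulmxE linear_sum.
by apply: eq_bigr => r _; rewrite linearZ mxE.
Qed.

Lemma gram_adjoint (g : K -> H) p q (W : 'rV[H]_p) (Z : 'rV[K]_q) :
  (forall x y, ip (f x) y = ip x (g y)) ->
  gram (map_mx f W) Z = gram W (map_mx g Z).
Proof. by move=> fg; apply/matrixP => i j; rewrite !mxE fg. Qed.

End QuasimatrixMap.

(** * Block columns *)

(** Blocks are indexed by ordinals, recurrences by natural numbers.  Multiplication
    by the block columns e_j, defined for every natural number j, reconciles the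
    two. *)
Section BlockColumns.
Variables (R : realType) (m n : nat).
Local Notation N := (\sum_(i < n) m)%N.
Local Notation e := (block_col R m n).

Lemma mulmx_block_col q (A : 'M[R]_(q, N)) (j : 'I_n) : A *m e j = submxrow A j.
Proof.
rewrite -{1}(submxrowK A) mul_mxrow_mxcol (bigD1 j)//= eqxx mulmx1 big1 ?addr0//.
by move=> i ij; rewrite val_eqE (negPf ij) raddf0 mulmx0.
Qed.

Lemma block_col_tr_mul q (A : 'M[R]_(N, q)) (i : 'I_n) :
  (e i)^T *m A = submxcol A i.
Proof.
rewrite -[LHS]trmxK trmx_mul trmxK mulmx_block_col.
by apply/matrixP => a b; rewrite !mxE.
Qed.

Lemma submxblock_block_col (A : 'M[R]_N) (i j : 'I_n) :
  submxblock A i j = (e i)^T *m A *m e j.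
Proof. by rewrite mulmx_block_col block_col_tr_mul submxblockEv. Qed.

Lemma block_col_orthonormal i j : (i < n)%N ->
  (e i)^T *m e j = (i == j)%:R%:M.
Proof.
move=> ilt; rewrite (block_col_tr_mul (e j) (Ordinal ilt)).
by rewrite /block_col mxcolK.
Qed.

(** The resolution of the identity by the block columns: it expands every
    product along the blocks. *)
Lemma block_col_sum : \sum_(i < n) e i *m (e i)^T = 1%:M.
Proof.
rewrite -[LHS]submxrowK -[RHS]submxrowK; apply/eq_mxrow => j.
rewrite -!mulmx_block_col mul1mx mulmx_suml [LHS](bigD1 j)//= [X in _ + X]big1 => [|i ij].
  by rewrite -mulmxA block_col_orthonormal// eqxx mulmx1 addr0.
by rewrite -mulmxA block_col_orthonormal// val_eqE (negPf ij) raddf0 mulmx0.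
Qed.

Variable H : hilbertType R.

Lemma qmulmx_block_col (W : 'rV[H]_N) (j : 'I_n) : W *q e j = submxrow W j.
Proof.
apply/rowP => s; rewrite qmulmxE !mxE.
have eE r : e j r s = (r == tagnat.Rank j s)%:R.
  by rewrite -[e j]mul1mx mulmx_block_col !mxE.
rewrite [LHS](bigD1 (tagnat.Rank j s))//= eE eqxx scale1r [X in _ + X]big1 ?addr0//.
by move=> r rs; rewrite eE (negPf rs) scale0r.
Qed.

Lemma quasimx_block_col (w : nat -> 'rV[H]_m) j : (j < n)%N ->
  quasimx n w *q e j = w j.
Proof.
by move=> jn; rewrite (qmulmx_block_col _ (Ordinal jn)) /quasimx mxrowK.
Qed.

Lemma qmulmx_blocks q (W : 'rV[H]_N) (A : 'M[R]_(N, q)) :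
  W *q A = \sum_(i < n) (W *q e i) *q ((e i)^T *m A).
Proof.
rewrite -{1}[A]mul1mx -block_col_sum mulmx_suml qmulmx_sumr.
by apply: eq_bigr => i _; rewrite !qmulmxA mulmxA.
Qed.

Lemma quasimx_indep_coef (w : nat -> 'rV[H]_m) (d : nat -> 'cV[R]_m) :
  lin_indep (quasimx n w) -> \sum_(i < n) w i *q d i = 0 ->
  forall i, (i < n)%N -> d i = 0.
Proof.
move=> iw wd0 i ilt; pose c := \sum_(k < n) e k *m d k.
have ec k : (k < n)%N -> (e k)^T *m c = d k.
  move=> kn; rewrite /c mulmx_sumr [LHS](bigD1 (Ordinal kn))//= [X in _ + X]big1 => [|l lk].
    by rewrite mulmxA block_col_orthonormal// eqxx mul1mx addr0.
  rewrite mulmxA block_col_orthonormal// -[k]/(val (Ordinal kn)) val_eqE.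
  by rewrite eq_sym (negPf lk) raddf0 mul0mx.
rewrite -ec// (iw c) ?mulmx0// qmulmx_blocks -[RHS]wd0.
by apply: eq_bigr => k _; rewrite ec// quasimx_block_col.
Qed.

End BlockColumns.

(** * Block spans *)

Section Span.
Variables (R : realType) (m : nat).

(** The m-tuples whose components are combinations of the components of
    w 0, ..., w j.  Membership matters only through its closure properties, so it is
    generated inductively instead of being given by coefficients. *)
Inductive in_span (H : hilbertType R) (w : nat -> 'rV[H]_m) (j : nat) :
    'rV[H]_m -> Prop :=
| in_span_gen i (A : 'M[R]_m) : (i <= j)%N -> in_span w j (w i *q A)
| in_spanD x y : in_span w j x -> in_span w j y -> in_span w j (x + y).

Variable H : hilbertType R.
Implicit Types w : nat -> 'rV[H]_m.

Lemma in_span_base w j i : (i <= j)%N -> in_span w j (w i).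
Proof. by move=> ij; rewrite -[w i]qmulmx1; exact: in_span_gen. Qed.

Lemma in_spanM w j x (A : 'M[R]_m) : in_span w j x -> in_span w j (x *q A).
Proof.
elim=> [i B ij|y z _ yA _ zA]; first by rewrite qmulmxA; exact: in_span_gen.
by rewrite qmulmxDl; exact: in_spanD.
Qed.

Lemma in_spanN w j x : in_span w j x -> in_span w j (- x).
Proof. by move=> /(in_spanM (- 1%:M)); rewrite qmulmxNr qmulmx1. Qed.

Lemma in_spanB w j x y : in_span w j x -> in_span w j y -> in_span w j (x - y).
Proof. by move=> wx wy; apply/in_spanD/in_spanN. Qed.

Lemma in_span_zero w j : in_span w j 0.
Proof. by rewrite -(qmulmx0r m (w 0)); exact: in_span_gen. Qed.

Lemma in_span_sum w j (I : Type) (s : seq I) (F : I -> 'rV[H]_m) :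
  (forall i, in_span w j (F i)) -> in_span w j (\sum_(i <- s) F i).
Proof.
move=> wF; elim/big_rec: _ => [|i x _ wx]; first exact: in_span_zero.
exact: in_spanD.
Qed.

Lemma in_span_trans w w' j k x :
  (forall i, (i <= j)%N -> in_span w' k (w i)) ->
  in_span w j x -> in_span w' k x.
Proof.
move=> ww'; elim=> [i A ij|y z _ wy _ wz]; last exact: in_spanD.
by apply: in_spanM; exact: ww'.
Qed.

Lemma in_span_widen w j k x : (j <= k)%N -> in_span w j x -> in_span w k x.
Proof.
move=> jk; apply: in_span_trans => i ij; apply: in_span_base.
exact: leq_trans jk.
Qed.

Lemma in_span_firstP w x : in_span w 0 x -> exists A, x = w 0 *q A.
Proof.
elim=> [i A|y z _ [A ->] _ [B ->]]; first by rewrite leqn0 => /eqP ->; exists A.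
by exists (A + B); rewrite qmulmxDr.
Qed.

End Span.

Lemma in_span_map (R : realType) (m : nat) (H K : hilbertType R)
    (f : {linear H -> K}) (w : nat -> 'rV[H]_m) (w' : nat -> 'rV[K]_m) j k x :
  (forall i, (i <= j)%N -> in_span w' k (map_mx f (w i))) ->
  in_span w j x -> in_span w' k (map_mx f x).
Proof.
move=> fw; elim=> [i A ij|y z _ wy _ wz].
  by rewrite map_qmulmx; apply: in_spanM; exact: fw.
by rewrite map_mxD; exact: in_spanD.
Qed.

Lemma big_ord_pair (V : nmodType) n (F : nat -> V) i j :
  (i < n)%N -> (j < n)%N -> i != j ->
  (forall k, (k < n)%N -> k != i -> k != j -> F k = 0) ->
  \sum_(k < n) F k = F i + F j.
Proof.
move=> ilt jlt ij F0; rewrite (bigD1 (Ordinal ilt))//=.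
rewrite (bigD1 (Ordinal jlt)) /=; last by rewrite -val_eqE /= eq_sym.
by rewrite big1 ?addr0// => k /andP[]; rewrite -!val_eqE/=; exact: F0.
Qed.

(** * Primary and dual snapshots *)

Section Snapshots.
Variables (R : realType) (H Hh : hilbertType R) (m : nat) (tau : R).
Hypothesis tau0 : 0 < tau.
Variables (Lc : {linear Hh -> H}) (LcT : {linear H -> Hh}) (P : H -> H).
Hypothesis LcLcT : forall x, (2 / tau ^+ 2) *: (x - P x) = Lc (LcT x).
Variables (b : 'rV[H]_m) (u : nat -> 'rV[H]_m).
Hypothesis u0 : u 0 = b.
Hypothesis Pu0 : map_mx P (u 0) = u 1.
Hypothesis Pu : forall j, map_mx P (u j.+1) *q 2%:M = u j.+2 + u j.
Local Notation uh := (dual_snapshot tau LcT b u).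

Lemma qmulmx_scalar (G : hilbertType R) p (W : 'rV[G]_p) (a : R) :
  W *q a%:M = map_mx ( *:%R a) W.
Proof.
apply/rowP => s; rewrite qmulmxE mxE (bigD1 s)//= [X in _ + X]big1 => [|r rs].
  by rewrite mxE eqxx addr0.
by rewrite mxE (negPf rs) scale0r.
Qed.

Lemma map_LcLcT p (w : 'rV[H]_p) :
  map_mx Lc (map_mx LcT w) = (w - map_mx P w) *q (2 / tau ^+ 2)%:M.
Proof. by apply/rowP => s; rewrite qmulmx_scalar !mxE LcLcT. Qed.

Lemma dual_snapshot0 : uh 0 = map_mx LcT (u 0) *q (tau / 2)%:M.
Proof. by apply/rowP => s; rewrite qmulmx_scalar u0 !mxE. Qed.

Lemma dual_snapshotS j : uh j.+1 = uh j + map_mx LcT (u j.+1) *q tau%:M.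
Proof.
by rewrite /=; congr (_ + _); apply/rowP => s; rewrite qmulmx_scalar !mxE.
Qed.

(** The staggered half of the leapfrog scheme.  The three-term recurrence says
    that the second difference of u at j is - tau ^ 2 Lc LcT u_j; the dual
    snapshots sum up tau LcT u_j, so - tau Lc uh_j is the first difference.
    The factor tau / 2 in uh_0 matches the reflection u_(-1) = u_1. *)
Lemma Lc_dual_snapshot j : map_mx Lc (uh j) *q tau%:M = u j - u j.+1.
Proof.
have tauN0 : tau != 0 by rewrite gt_eqF.
elim: j => [|j IH].
  rewrite dual_snapshot0 map_qmulmx map_LcLcT !qmulmxA -!scalar_mxM Pu0.
  have -> : 2 / tau ^+ 2 * (tau / 2 * tau) = 1 by field.
  by rewrite qmulmx1.
rewrite dual_snapshotS map_mxD qmulmxDl IH map_qmulmx map_LcLcT !qmulmxA.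
rewrite -!scalar_mxM.
have -> : 2 / tau ^+ 2 * (tau * tau) = 2 by field.
have two : u j.+1 *q 2%:M = u j.+1 + u j.+1.
  by rewrite [2]/(1 + 1) raddfD /= qmulmxDr qmulmx1.
rewrite qmulmxDl qmulmxNl Pu two.
by rewrite opprD !addrA subrK -addrA [- _ - _]addrC addrACA subrr add0r.
Qed.

Lemma LcT_span_dual j i : (i <= j)%N -> in_span uh j (map_mx LcT (u i)).
Proof.
case: i => [|i] ij.
  have <- : uh 0 *q (2 / tau)%:M = map_mx LcT (u 0).
    rewrite dual_snapshot0 qmulmxA -scalar_mxM.
    have -> : tau / 2 * (2 / tau) = 1 by field; rewrite gt_eqF.
    by rewrite qmulmx1.
  exact: in_span_gen.
have <- : (uh i.+1 - uh i) *q (tau^-1)%:M = map_mx LcT (u i.+1).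
  rewrite dual_snapshotS addrAC subrr add0r qmulmxA -scalar_mxM.
  by rewrite divff ?qmulmx1// gt_eqF.
apply: in_spanM; apply: in_spanB; apply: in_span_base => //; exact: ltnW.
Qed.

Lemma Lc_dual_span j i : (i <= j)%N -> in_span u j.+1 (map_mx Lc (uh i)).
Proof.
move=> ij.
have <- : (u i - u i.+1) *q (tau^-1)%:M = map_mx Lc (uh i).
  rewrite -Lc_dual_snapshot qmulmxA -scalar_mxM.
  by rewrite divff ?qmulmx1// gt_eqF.
apply: in_spanM; apply: in_spanB; apply: in_span_base => //; exact: ltnW.
Qed.

(** Apply Lc to a vanishing combination of the uh_j: it becomes a combination
    of the differences u_j - u_(j+1), j < n.  Its coefficients on u_0, ..., u_n
    vanish, and they are the successive differences of the original
    coefficients.  This is where the snapshot at time n tau enters. *)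
Lemma dual_snapshot_indep n :
  lin_indep (quasimx n.+1 u) -> lin_indep (quasimx n uh).
Proof.
move=> iu c uhc.
(* d extends the blocks of c by zero, so that d n = 0 in the summation by parts *)
pose d k : 'cV[R]_m := if (k < n)%N then (block_col R m n k)^T *m c else 0.
have uhd : \sum_(k < n) uh k *q d k = 0.
  rewrite -[RHS]uhc qmulmx_blocks; apply: eq_bigr => k _.
  by rewrite quasimx_block_col// /d ltn_ord.
have ud : \sum_(k < n) (u k - u k.+1) *q d k = 0.
  have := congr1 (fun w => map_mx Lc w *q (tau%:M : 'M[R]_1)) uhd.
  have -> : map_mx Lc (0 : 'rV[Hh]_1) = 0 by exact: map_mx0.
  rewrite qmulmx0l => uhd'; rewrite -[RHS]uhd' map_mx_sum qmulmx_suml.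
  apply: eq_bigr => k _; rewrite -Lc_dual_snapshot.
  by rewrite map_qmulmx !qmulmxA mul_scalar_mx mul_mx_scalar.
pose d' k : 'cV[R]_m := d k - (if k is l.+1 then d l else 0).
have ud' : \sum_(k < n.+1) u k *q d' k = 0.
  have dn : d n = 0 by rewrite /d ltnn.
  rewrite -[RHS]ud; under [LHS]eq_bigr do rewrite qmulmxDr qmulmxNr.
  under [RHS]eq_bigr do rewrite qmulmxDl qmulmxNl.
  rewrite !big_split /= big_ord_recr /= dn qmulmx0r addr0; congr (_ + _).
  by rewrite big_ord_recl /= qmulmx0r oppr0 add0r.
have d'0 := quasimx_indep_coef iu ud'.
have d0 k : (k < n)%N -> d k = 0.
  elim: k => [|k IH] kn; have := d'0 _ (leqW kn); rewrite /d'.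
    by rewrite subr0.
  by rewrite IH ?subr0// ltnW.
rewrite -[c]mul1mx -block_col_sum mulmx_suml [LHS]big1// => k _.
by have := d0 k (ltn_ord k); rewrite /d ltn_ord -mulmxA => ->; rewrite mulmx0.
Qed.

(** * The reduced order model *)

Section ROM.
Variable n : nat.
Local Notation N := (\sum_(i < n) m)%N.
Local Notation e := (block_col R m n).
Local Notation U := (quasimx n u).
Local Notation Uh := (quasimx n uh).
Hypothesis adj : forall x y, ip (Lc x) y = ip x (LcT y).
Hypothesis indep : lin_indep (quasimx n.+1 u).
Variables Rc LR : 'M[R]_N.
Hypothesis Rc_upper : block_upper Rc.
Hypothesis Rc_unit : Rc \in unitmx.
Hypothesis chol : gram U U = Rc^T *m Rc.
Local Notation PR := (rom_propagator (gram U (map_mx P U)) Rc).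
Hypothesis LR_chol : (2 / tau ^+ 2) *: (1%:M - PR) = LR *m LR^T.
Local Notation V := (U *q invmx Rc).
Local Notation Rh := (\mxrow_(j < n)
  rom_dual_snapshot tau LR (Rc *m e 0) (rom_snapshot PR Rc) j).
Local Notation Vh := (Uh *q invmx Rh).

Lemma primary_orthonormal : gram V V = 1%:M.
Proof.
rewrite gram_mull gram_mulr chol trmx_inv -!mulmxA mulmxV// mulmx1.
by rewrite mulVmx// unitmx_tr.
Qed.

Lemma snapshot_primary j : (j < n)%N -> u j = V *q (Rc *m e j).
Proof. by move=> jn; rewrite qmulmxA mulmxA mulVmx// mul1mx quasimx_block_col. Qed.

(** Block triangularity of R makes the Gram-Schmidt process causal. *)
Lemma snapshot_span j i : (i <= j)%N -> (j < n)%N ->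
  in_span (fun k => V *q e k) j (u i).
Proof.
move=> ij jn; have ilt := leq_ltn_trans ij jn.
rewrite snapshot_primary// [X in in_span _ _ X]qmulmx_blocks.
apply: in_span_sum => k.
have [kj|jk] := leqP k j; first exact: (in_span_gen (fun k => V *q e k)).
rewrite mulmxA -(submxblock_block_col Rc k (Ordinal ilt)) Rc_upper/=.
  by rewrite qmulmx0r; exact: in_span_zero.
exact: leq_ltn_trans jk.
Qed.

Lemma rom_snapshotSS (PP : 'M[R]_N) j : rom_snapshot PP Rc j.+2 =
  2 *: (PP *m rom_snapshot PP Rc j.+1) - rom_snapshot PP Rc j.
Proof. by []. Qed.

(** R e_j is the coordinate of the true snapshot u_j in V, and the ROM
    propagator is the compression of P to the span of V.  As P u_j, for
    j + 1 < n, stays in that span, the compressed recurrence reproduces the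
    true one. *)
Lemma rom_snapshotE j : (j < n)%N -> rom_snapshot PR Rc j = Rc *m e j.
Proof.
suff : ((j < n)%N -> rom_snapshot PR Rc j = Rc *m e j) /\
   ((j.+1 < n)%N -> rom_snapshot PR Rc j.+1 = Rc *m e j.+1) by case.
elim: j => [//|j [IH IH1]]; split=> // jn.
have [jn1 jn0] : (j.+1 < n)%N /\ (j < n)%N by split; rewrite ?(ltnW jn) ?(ltnW (ltnW jn)).
rewrite rom_snapshotSS IH1// IH//.
have PRe : 2 *: (PR *m (Rc *m e j.+1)) = Rc *m (e j.+2 + e j).
  rewrite /rom_propagator -[_ *m invmx Rc *m _]mulmxA [invmx Rc *m _]mulmxA.
  rewrite mulVmx// mul1mx -mulmxA scalemxAr -mul_mx_scalar -gram_mulr.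
  have PUe : map_mx P U *q e j.+1 = map_mx P (u j.+1).
    rewrite -[j.+1]/(val (Ordinal jn1)) qmulmx_block_col.
    rewrite -[in RHS](quasimx_block_col u (ltn_ord (Ordinal jn1))).
    by rewrite qmulmx_block_col; apply/rowP => s; rewrite !mxE.
  rewrite -gram_mulr PUe Pu -[u j.+2](quasimx_block_col u jn).
  rewrite -[u j](quasimx_block_col u jn0) -qmulmxDr gram_mulr chol.
  by rewrite trmx_inv !mulmxA mulVmx ?mul1mx// unitmx_tr.
by rewrite PRe mulmxDr addrK.
Qed.

Local Notation uR := (rom_snapshot PR Rc).
Local Notation Y := (\mxrow_(j < n) rom_dual_snapshot tau 1%:M (Rc *m e 0) uR j).

(** With the identity in place of L^ROM, the ROM dual snapshots are the
    coordinates of the dual snapshots in LcT V; these form Y.  Factoring both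
    families through Y compares them. *)
Lemma rom_dualE : Rh = LR^T *m Y.
Proof.
rewrite mul_mxrow; apply: eq_mxrow => j.
elim: (val j) => [|k IH] /=; rewrite trmx1 mul1mx; first by rewrite -scalemxAr.
by rewrite mulmxDr IH scalemxAr.
Qed.

Lemma dual_snapshot_coord : Uh = map_mx LcT V *q Y.
Proof.
rewrite -[Uh]submxrowK -[RHS]submxrowK; apply/eq_mxrow => j.
rewrite -!qmulmx_block_col.
rewrite quasimx_block_col// qmulmxA mulmx_block_col mxrowK.
elim: (val j) (ltn_ord j) => [|k IH] kn.
  rewrite dual_snapshot0 (snapshot_primary kn) map_qmulmx qmulmxA /=.
  by rewrite trmx1 mul1mx mul_mx_scalar.
rewrite dual_snapshotS (snapshot_primary kn) map_qmulmx qmulmxA (IH (ltnW kn)).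
by rewrite -qmulmxDr mul_mx_scalar -(rom_snapshotE kn) [in RHS]/= trmx1 mul1mx.
Qed.

(** The Gram matrix of LcT V is the compression to V of
    Lc LcT = (2 / tau ^ 2) (I - P), which L^ROM factors by definition. *)
Lemma gram_LcT_primary : gram (map_mx LcT V) (map_mx LcT V) = LR *m LR^T.
Proof.
have adj' x y : ip (LcT x) y = ip x (Lc y) by rewrite ipC -adj ipC.
rewrite (gram_adjoint V _ adj') map_LcLcT gram_mulr gramDr gramNr.
rewrite primary_orthonormal mul_mx_scalar -LR_chol; congr (_ *: (_ - _)).
have -> : map_mx P V = map_mx P U *q invmx Rc.
  (* P = I - (tau ^ 2 / 2) Lc LcT inherits linearity from Lc LcT *)
  have PE p (w : 'rV[H]_p) :
      map_mx P w = w - map_mx Lc (map_mx LcT w) *q (2 / tau ^+ 2)^-1%:M.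
    rewrite map_LcLcT qmulmxA -scalar_mxM divff ?qmulmx1 ?subKr//.
    by rewrite mulf_neq0 ?invr_neq0 ?expf_neq0 ?gt_eqF.
  rewrite !PE qmulmxDl qmulmxNl !map_qmulmx !qmulmxA.
  by rewrite mul_mx_scalar mul_scalar_mx.
by rewrite gram_mull gram_mulr trmx_inv /rom_propagator trmx_inv mulmxA.
Qed.

Lemma dual_gram : gram Uh Uh = Rh^T *m Rh.
Proof.
rewrite [in LHS]dual_snapshot_coord gram_mull gram_mulr gram_LcT_primary.
rewrite rom_dualE.
by rewrite trmx_mul trmxK !mulmxA.
Qed.

(** The dual snapshots are independent, so their Gram matrix is invertible, and
    it is Rh^T Rh.  Invertibility of L^ROM is contained in this. *)
Lemma rom_dual_unit : Rh \in unitmx.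
Proof.
have := gram_unit (dual_snapshot_indep indep).
by rewrite dual_gram unitmx_mul => /andP[].
Qed.

Lemma dual_orthonormal : gram Vh Vh = 1%:M.
Proof.
rewrite gram_mull gram_mulr dual_gram trmx_inv -!mulmxA mulmxV ?rom_dual_unit//.
by rewrite mulmx1 mulVmx// unitmx_tr rom_dual_unit.
Qed.

Lemma LcT_primary : map_mx LcT V = Vh *q LR^T.
Proof.
have : LR^T *m (Y *m invmx Rh) = 1%:M.
  by rewrite mulmxA -rom_dualE mulmxV// rom_dual_unit.
by move/mulmx1C => YL; rewrite dual_snapshot_coord !qmulmxA mulmxA YL qmulmx1.
Qed.

End ROM.
End Snapshots.

(** * Comparison with the block Lanczos iteration *)

Section LanczosUniqueness.
Variables (R : realType) (H Hh : hilbertType R) (m n : nat).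
Variables (Lc : {linear Hh -> H}) (LcT : {linear H -> Hh}).
Hypothesis adj : forall x y, ip (Lc x) y = ip x (LcT y).
Local Notation N := (\sum_(i < n) m)%N.
Local Notation e := (block_col R m n).

Variables (V : 'rV[H]_N) (Vh : 'rV[Hh]_N) (L : 'M[R]_N).
Hypothesis V1 : gram V V = 1%:M.
Hypothesis Vh1 : gram Vh Vh = 1%:M.
Hypothesis LcTV : map_mx LcT V = Vh *q L^T.
Hypothesis L_lower : block_lower L.
Let v j := V *q e j.
Let vh j := Vh *q e j.
Let Lb i j := (e i)^T *m L *m e j.

Variables (u : nat -> 'rV[H]_m) (uh : nat -> 'rV[Hh]_m).
Hypothesis u_span : forall j i, (i <= j)%N -> (j < n)%N -> in_span v j (u i).
Hypothesis LcTu : forall j i, (i <= j)%N -> in_span uh j (map_mx LcT (u i)).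
Hypothesis Lcuh : forall j i, (i <= j)%N -> in_span u j.+1 (map_mx Lc (uh i)).

Variables (phi : nat -> 'rV[H]_m) (phih : nat -> 'rV[Hh]_m).
Hypothesis iter : block_iteration n Lc LcT (u 0) phi phih.
Hypothesis phi_indep :
  forall j, (j < n)%N -> lin_indep (phi j) /\ lin_indep (phih j).

Lemma phi0 : phi 0 = u 0. Proof. by case: iter. Qed.

Lemma phi_step j : (j < n)%N ->
  (phi j.+1 - phi j) *q gram (phih j) (phih j) = - map_mx Lc (phih j).
Proof. by move=> jn; have [_ /(_ j jn)[<- _]] := iter; rewrite invmxK. Qed.

Lemma phih_step j : (j < n)%N ->
  (phih j - (if j is k.+1 then phih k else 0)) *q gram (phi j) (phi j)
  = map_mx LcT (phi j).
Proof. by move=> jn; have [_ /(_ j jn)[_ <-]] := iter; rewrite invmxK. Qed.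

Lemma qmulmx_cancel (K : hilbertType R) p (W Z : 'rV[K]_p) (A : 'M[R]_p) :
  A \in unitmx -> W *q A = Z -> W = Z *q invmx A.
Proof. by move=> uA <-; rewrite qmulmxA mulmxV// qmulmx1. Qed.

(** The iteration applies Lc and LcT alternately, exactly as the snapshots do,
    so it stays in the spans of the snapshots. *)
Lemma iteration_span j : (j < n)%N -> in_span u j (phi j) /\ in_span uh j (phih j).
Proof.
elim: j => [|j IH] jn.
  have phi_u : in_span u 0 (phi 0) by rewrite phi0; exact: in_span_base.
  split=> //; have := phih_step jn; rewrite subr0.
  have [/gram_unit uG _] := phi_indep jn.
  move/(qmulmx_cancel uG) => ->; apply: in_spanM.
  by apply: in_span_map phi_u => i; exact: LcTu.
have [phi_u phih_u] := IH (ltnW jn).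
have phiS : in_span u j.+1 (phi j.+1).
  rewrite -(subrK (phi j) (phi j.+1)); apply: in_spanD.
    have [_ /gram_unit uG] := phi_indep (ltnW jn).
    have /(qmulmx_cancel uG) -> := phi_step (ltnW jn).
    apply/in_spanM/in_spanN; apply: in_span_map phih_u => i; exact: Lcuh.
  exact: in_span_widen phi_u.
split=> //; rewrite -(subrK (phih j) (phih j.+1)); apply: in_spanD.
  have [/gram_unit uG _] := phi_indep jn.
  have /(qmulmx_cancel uG) -> := phih_step jn.
  by apply: in_spanM; apply: in_span_map phiS => i; exact: LcTu.
exact: in_span_widen phih_u.
Qed.

(** The adjoint of LcT V = Vh L^T, taken in orthonormal bases. *)
Lemma gram_Lc : gram V (map_mx Lc Vh) = L.
Proof.
have adj' x y : ip (LcT x) y = ip x (Lc y) by rewrite ipC -adj ipC.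
by rewrite -(gram_adjoint _ _ adj') LcTV gram_mull Vh1 mulmx1 trmxK.
Qed.

Lemma gram_v_Lc_vh k j : gram (v k) (map_mx Lc (vh j)) = Lb k j.
Proof. by rewrite map_qmulmx gram_mulr gram_mull gram_Lc. Qed.

Lemma span_v_orthogonal j k x : (k < n)%N -> (j < k)%N ->
  in_span v j x -> gram (v k) x = 0.
Proof.
move=> kn jk; elim=> [i A ij|y z _ yv _ zv]; last by rewrite gramDr yv zv addr0.
rewrite gram_mulr gram_mulr gram_mull V1 mulmx1 block_col_orthonormal//.
by rewrite gtn_eqF ?raddf0 ?mul0mx//; exact: leq_ltn_trans jk.
Qed.

Lemma span_v_expand j x : in_span v j x -> x = V *q gram V x.
Proof.
elim=> [i A ij|y z _ yv _ zv]; last by rewrite gramDr qmulmxDr -yv -zv.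
by rewrite !gram_mulr V1 mul1mx qmulmxA.
Qed.

Lemma Lb_lower i j : (i < n)%N -> (j < n)%N -> (i < j)%N -> Lb i j = 0.
Proof.
move=> ilt jlt ij; rewrite /Lb.
by rewrite -(submxblock_block_col L (Ordinal ilt) (Ordinal jlt)) L_lower.
Qed.

Lemma gram_v_self j : (j < n)%N -> gram (v j) (v j) = 1%:M.
Proof.
by move=> jn; rewrite gram_mull gram_mulr V1 mul1mx block_col_orthonormal// eqxx.
Qed.

Lemma gram_vh_self j : (j < n)%N -> gram (vh j) (vh j) = 1%:M.
Proof.
by move=> jn; rewrite gram_mull gram_mulr Vh1 mul1mx block_col_orthonormal// eqxx.
Qed.

Let X j := gram (v j) (phi j).
Let Y j := gram (vh j) (phih j).

(** The induction hypothesis.  X_j and Y_j are the inverses of the square roots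
    to be found.  The last clause, bidiagonality of column j of L^ROM, belongs
    here because it is derived from phih_j and is needed to evaluate Lc vh_j
    and LcT v_k at the next steps. *)
Definition matched j := [/\ phi j = v j *q X j, phih j = vh j *q Y j,
  X j \in unitmx /\ Y j \in unitmx, Lb j j = X j *m (Y j)^T
  & forall k, (k < n)%N -> (j.+1 < k)%N -> Lb k j = 0].

(** By bidiagonality Lc vh_i = v_i L_(i,i) + v_(i+1) L_(i+1,i).  In the step of
    the iteration from phi_i = v_i X_i, the v_i component is v_i X_i because
    L_(i,i) = X_i Y_i^T, so it cancels phi_i; only the multiple of v_(i+1)
    remains. *)
Lemma matched_primary j : (j < n)%N ->
  (forall i, (i < j)%N -> matched i) ->
  phi j = v j *q X j /\
  (forall i, j = i.+1 -> Lb j i = - (X j *m (Y i)^T)).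
Proof.
have XE A i : (i < n)%N -> phi i = v i *q A -> X i = A.
  by move=> ilt phiE; rewrite /X phiE gram_mulr gram_v_self// mul1mx.
case: j => [|i] jn IH.
  split=> //; have [A phiA] : exists A, phi 0 = v 0 *q A.
    by apply: in_span_firstP; rewrite phi0; exact: u_span.
  by rewrite (XE _ _ jn phiA).
have [phiE phihE [uX uY] Lii bid] := IH i (leqnn _).
have ilt := ltnW jn.
have Lc_vh : map_mx Lc (vh i) = v i *q Lb i i + v i.+1 *q Lb i.+1 i.
  (* Lc vh_i may leave the span of V only for i = n - 1 *)
  have sp : in_span v i.+1 (map_mx Lc (vh i)).
    have -> : vh i = phih i *q invmx (Y i).
      by rewrite phihE qmulmxA mulmxV// qmulmx1.
    rewrite map_qmulmx; apply: in_spanM.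
    have : in_span u i.+1 (map_mx Lc (phih i)).
      have [_ phih_u] := iteration_span ilt.
      by apply: in_span_map phih_u => l; exact: Lcuh.
    by apply: in_span_trans => l li; exact: u_span.
  rewrite {1}(span_v_expand sp) qmulmx_blocks.
  rewrite -(@big_ord_pair _ n (fun k => v k *q Lb k i))//; last 2 first.
  - by rewrite ltn_eqF.
  - move=> k kn ki ki1; suff -> : Lb k i = 0 by rewrite qmulmx0r.
    have [ki'|ik] := ltnP k i; first exact: Lb_lower.
    apply: bid => //; rewrite ltn_neqAle eq_sym ki1/=.
    by rewrite ltn_neqAle eq_sym ki.
  by apply: eq_bigr => k _; rewrite -gram_v_Lc_vh gram_mull.
have stepE : (phi i.+1) *q (Y i)^T = v i.+1 *q - Lb i.+1 i.
  rewrite qmulmxNr; have := phi_step ilt.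
  have -> : gram (phih i) (phih i) = (Y i)^T *m Y i.
    by rewrite phihE gram_mull gram_mulr gram_vh_self// mul1mx.
  rewrite [in RHS]phihE map_qmulmx -qmulmxNl -qmulmxA.
  move/(qmulmx_cancel uY); rewrite qmulmxA mulmxV// qmulmx1 Lc_vh.
  rewrite qmulmxDl qmulmxNl Lii opprD -qmulmxA -phiE.
  by rewrite [RHS]addrC => /addIr.
have uYT : (Y i)^T \in unitmx by rewrite unitmx_tr.
have phiS := qmulmx_cancel uYT stepE; rewrite qmulmxA in phiS.
have XS := XE _ _ jn phiS; split=> [|k [<-]]; first by rewrite XS.
by rewrite XS -mulmxA mulVmx// mulmx1 opprK.
Qed.

(** Row j of L^ROM has only the entries j - 1 and j.  The entry j - 1 is
    expressed by phih_(j-1), which makes it cancel the previous iterate in the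
    dual step. *)
Lemma LcT_v j (prev := if j is k.+1 then phih k else 0) : (j < n)%N ->
  (forall i, (i < j)%N -> matched i) ->
  map_mx LcT (v j) = vh j *q (Lb j j)^T - prev *q (X j)^T.
Proof.
move=> jn IH; have [_ Lsub] := matched_primary jn IH.
rewrite map_qmulmx LcTV qmulmxA qmulmx_blocks.
have -> : \sum_(k < n) vh k *q ((e k)^T *m (L^T *m e j)) =
          \sum_(k < n) vh k *q (Lb j k)^T.
  by apply: eq_bigr => k _; rewrite /Lb !trmx_mul trmxK.
case: j @prev jn IH Lsub => [|i] prev jn IH Lsub.
  rewrite qmulmx0l subr0 (bigD1 (Ordinal jn))//= big1 ?addr0// => k k0.
  rewrite Lb_lower ?trmx0 ?qmulmx0r// lt0n; exact: k0.
have ilt := ltnW jn.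
have [_ phihE _ _ _] := IH i (leqnn _).
rewrite (@big_ord_pair _ n (fun k => vh k *q (Lb i.+1 k)^T) i.+1 i)//; last 2 first.
- by rewrite gtn_eqF.
- move=> k kn ki1 ki; suff -> : Lb i.+1 k = 0 by rewrite trmx0 qmulmx0r.
  have [ik|ki'] := ltnP i.+1 k; first exact: Lb_lower.
  have ki2 : (k < i)%N.
    by rewrite ltn_neqAle ki -ltnS ltn_neqAle ki1.
  by have [_ _ _ _ bid] := IH k (ltnW ki2); exact: bid.
rewrite (Lsub i)// /prev phihE qmulmxA -qmulmxNr.
have trN (A : 'M[R]_m) : (- A)^T = - A^T by apply/matrixP => a c; rewrite !mxE.
by rewrite trN [(X _ *m _)^T]trmx_mul trmxK.
Qed.

Lemma iteration_matched j : (j < n)%N -> matched j.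
Proof.
elim/ltn_ind: j => j IH' jn.
have IH i : (i < j)%N -> matched i.
  by move=> ij; apply: IH' => //; exact: ltn_trans jn.
have [phiE _] := matched_primary jn IH.
have [phi_i phih_i] := phi_indep jn.
have uX := orthonormal_coord_unit (gram_v_self jn) phi_i phiE.
have uXT : (X j)^T \in unitmx by rewrite unitmx_tr.
have stepE : phih j *q (X j)^T = vh j *q (Lb j j)^T.
  have := phih_step jn; set prev := (if j is _.+1 then _ else _).
  have -> : gram (phi j) (phi j) = (X j)^T *m X j.
    by rewrite phiE gram_mull gram_mulr gram_v_self// mul1mx.
  rewrite [in RHS]phiE map_qmulmx LcT_v// -/prev -qmulmxA.
  move/(qmulmx_cancel uX); rewrite qmulmxA mulmxV// qmulmx1.
  by rewrite qmulmxDl qmulmxNl => /addIr.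
have := qmulmx_cancel uXT stepE; rewrite qmulmxA => phihE.
have YE : Y j = (Lb j j)^T *m invmx (X j)^T.
  by rewrite /Y phihE gram_mulr gram_vh_self// mul1mx.
rewrite -YE in phihE.
have uY := orthonormal_coord_unit (gram_vh_self jn) phih_i phihE.
split=> // [|k kn jk].
  by rewrite YE trmx_mul trmxK trmx_inv trmxK mulmxA mulmxV// mul1mx.
(* Lc vh_j lies in the span of v_0, ..., v_(j+1), which v_k is orthogonal to *)
have jn1 : (j.+1 < n)%N := ltn_trans jk kn.
rewrite -gram_v_Lc_vh; apply: (span_v_orthogonal kn jk).
have -> : vh j = phih j *q invmx (Y j) by rewrite phihE qmulmxA mulmxV// qmulmx1.
rewrite map_qmulmx; apply: in_spanM.
have : in_span u j.+1 (map_mx Lc (phih j)).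
  have [_ phih_u] := iteration_span jn.
  by apply: in_span_map phih_u => l; exact: Lcuh.
by apply: in_span_trans => l li; exact: u_span.
Qed.

Lemma lanczos_uniqueness :
  exists Gam Gamh : 'I_n -> 'M[R]_m,
    (forall j : 'I_n,
       coef phih j = Gam j *m (Gam j)^T /\ coef phi j = Gamh j *m (Gamh j)^T) /\
    (forall j : 'I_n,
       submxrow V j = phi j *q Gamh j /\ submxrow Vh j = phih j *q Gam j) /\
    (forall j : 'I_n,
       submxblock L j j = invmx (Gamh j) *m (invmx (Gam j))^T) /\
    (forall i j : 'I_n, i = j.+1 :> nat ->
       submxblock L i j = - (invmx (Gamh i) *m (invmx (Gam j))^T)).
Proof.
exists (fun j => invmx (Y j)), (fun j => invmx (X j)).
have inv_gram (A : 'M[R]_m) : A \in unitmx ->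
    invmx (A^T *m A) = invmx A *m (invmx A)^T.
  move=> uA; have uAA : A^T *m A \in unitmx by rewrite unitmx_mul unitmx_tr uA.
  rewrite -[RHS]mul1mx -(mulVmx uAA) -!mulmxA [A *m _]mulmxA mulmxV// mul1mx.
  by rewrite trmx_inv mulmxV ?mulmx1// unitmx_tr.
split=> [j|].
  have [phiE phihE [uX uY] _ _] := iteration_matched (ltn_ord j).
  have gphi : gram (phi j) (phi j) = (X j)^T *m X j.
    by rewrite phiE gram_mull gram_mulr gram_v_self// mul1mx.
  have gphih : gram (phih j) (phih j) = (Y j)^T *m Y j.
    by rewrite phihE gram_mull gram_mulr gram_vh_self// mul1mx.
  by rewrite /coef gphi gphih !inv_gram.
split=> [j|].
  have [phiE phihE [uX uY] _ _] := iteration_matched (ltn_ord j).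
  by split; rewrite -qmulmx_block_col; apply: qmulmx_cancel => //; exact/esym.
split=> [j|i j ij]; rewrite !invmxK submxblock_block_col.
  by have [_ _ _ Ljj _] := iteration_matched (ltn_ord j); exact: Ljj.
have [|_ Lij] := matched_primary (ltn_ord i); last exact: Lij.
by move=> k ki; apply: iteration_matched; exact: ltn_trans (ltn_ord i).
Qed.

End LanczosUniqueness.

(** * The orthonormal snapshots and the iteration *)

Theorem theorem2p7 (R : realType) (K H Hh : hilbertType R)
  (m n : nat) (tau : R)
  (hm : (1 <= m)%N) (hn : (2 <= n)%N) (htau : 0 < tau)
  (* the operator L(q), and the spectral measure of A = L(q) L(q)^T *)
  (Lq : set (K * H)) (hLq : densely_defined_operator Lq)
  (hAsa : op_self_adjoint (op_comp Lq (op_adjoint Lq)))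
  (hApos : op_nonneg (op_comp Lq (op_adjoint Lq)))
  (E : set (measurableTypeR R) -> H -> H)
  (mu : H -> {measure set (measurableTypeR R) -> \bar R})
  (hE : spectral_measure (op_comp Lq (op_adjoint Lq)) E mu)
  (* C t = cos (t sqrt A); the propagator is C tau *)
  (C : R -> H -> H)
  (hC : forall t : R,
     functional_calculus mu (fun l => cos (t * Num.sqrt l)) (C t))
  (Lc : {linear Hh -> H}) (LcT : {linear H -> Hh})
  (hLcb : bounded_operator Lc)
  (hLcT : forall x y, ip (Lc x) y = ip x (LcT y))
  (hLc : forall x, (2 / tau ^+ 2) *: (x - C tau x) = Lc (LcT x))
  (b : 'rV[H]_m)
  (hindep : lin_indep (quasimx n.+1 (snapshot tau C b)))
  (Rc LR : 'M[R]_(\sum_(i < n) m)) :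
  let u := snapshot tau C b in
  let U := quasimx n u in
  let Uh := quasimx n (dual_snapshot tau LcT b u) in
  let M := gram U U in
  let S := gram U (map_mx (C tau) U) in
  block_upper Rc -> Rc \in unitmx -> M = Rc^T *m Rc ->
  let PR := rom_propagator S Rc in
  let bR := Rc *m block_col R m n 0 in
  let uR := rom_snapshot PR Rc in
  block_lower LR -> (2 / tau ^+ 2) *: (1%:M - PR) = LR *m LR^T ->
  let Rh := \mxrow_(j < n) rom_dual_snapshot tau LR bR uR j in
  let V := U *q invmx Rc in
  let Vh := Uh *q invmx Rh in
  forall (phi : nat -> 'rV[H]_m) (phih : nat -> 'rV[Hh]_m),
  block_iteration n Lc LcT b phi phih ->
  (forall j, (j < n)%N -> lin_indep (phi j) /\ lin_indep (phih j)) ->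
  exists Gam Gamh : 'I_n -> 'M[R]_m,
    (forall j : 'I_n,
       coef phih j = Gam j *m (Gam j)^T /\ coef phi j = Gamh j *m (Gamh j)^T) /\
    (forall j : 'I_n,
       submxrow V j = phi j *q Gamh j /\ submxrow Vh j = phih j *q Gam j) /\
    (forall j : 'I_n,
       submxblock LR j j = invmx (Gamh j) *m (invmx (Gam j))^T) /\
    (forall i j : 'I_n, i = j.+1 :> nat ->
       submxblock LR i j = - (invmx (Gamh i) *m (invmx (Gam j))^T)).
Proof.
move=> u U Uh M S Rc_upper Rc_unit chol PR bR uR LR_lower LR_chol Rh V Vh phi phih
  iter indep.
have [pvm _ _] := hE.
have u0 : u 0 = b.
  by apply/rowP => s; rewrite /u /snapshot mxE mul0r (cos_calculus0 pvm hC).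
have Pu0 : map_mx (C tau) (u 0) = u 1.
  by apply/rowP => s; rewrite u0 !mxE mul1r.
(* 2 cos s cos t = cos (s + t) + cos (s - t), with s = tau, t = (j + 1) tau *)
have Pu j : map_mx (C tau) (u j.+1) *q 2%:M = u j.+2 + u j.
  apply/rowP => s; rewrite qmulmx_scalar !mxE (cos_calculusD pvm hC).
  rewrite scalerA divff// scale1r -(cos_calculusN hC (_ - _)) opprB.
  by congr (C _ _ + C _ _); rewrite -!natr1; ring.
rewrite -u0 in iter.
apply: (lanczos_uniqueness (u := u) (uh := dual_snapshot tau LcT b u)
  hLcT _ _ _ LR_lower _ _ _ iter indep).
- exact: (primary_orthonormal Rc_unit chol).
- exact: (dual_orthonormal htau hLc u0 Pu0 Pu hLcT hindep Rc_unit chol LR_chol).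
- exact: (LcT_primary htau hLc u0 Pu0 Pu hLcT hindep Rc_unit chol LR_chol).
- by move=> j i ij jn; exact: snapshot_span.
- exact: LcT_span_dual.
- exact: (Lc_dual_span htau hLc u0 Pu0 Pu).
Qed.
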